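(* Let $u_0=1_{[0,1)}$, and let $\ell:[0,+\infty)\to[0,+\infty)$ be the right-continuous function whose generalized graph is the polygonal curve $\mathcal P$ through the points $G_0,g_0,G_1,g_1,\dots,G_n,g_n,\dots$ (in this order), where $G_n=(T_n,M_n)$, $g_n=(t_n,m_n)$ and the sequences $(T_n),(M_n),(t_n),(m_n)$ are those defined recursively in the context. Then $$\ell(t)=u_0(t)+\bigl|\{\,s\in[0,t]:\ \ell(t-s)>s\,\}\bigr|\qquad\forall t\in[0,+\infty).$$
   Context: $|\cdot|$ denotes one-dimensional Lebesgue measure; $1_A$ is the characteristic function of $A$. The generalized graph of a function is its graph with the addition of vertical segments joining left and right limits at jump points (here including the initial vertical segment $\{0\}\times[0,1]$). Definition of the sequences. Put $\alpha_n:=\frac1{n+1}$ for $n\ge0$. Put $T_0:=0$, $M_0:=0$, $t_0:=0$, $m_0:=1$. For $n\ge0$ set $$t^*_{n+1}:=t_n+m_n,\quad m^*_{n+1}:=m_n,\quad T^*_{n+1}:=T_n+M_n,\quad M^*_{n+1}:=M_n,\quad \Delta^*_n:=T^*_{n+1}-t^*_{n+1}.$$ If $\Delta^*_n\le0$: $$T_{n+1}:=T^*_{n+1}+\delta_n,\quad M_{n+1}:=M^*_{n+1}+2\delta_n,\quad t_{n+1}:=t^*_{n+1},\quad m_{n+1}:=m^*_{n+1},$$ where $\delta_0=1$ and $\delta_n=0$ for $n\geq 1$. If $\Delta^*_n>0$: $$T_{n+1}:=t^*_{n+1},\quad M_{n+1}:=M^*_{n+1}-\Delta^*_n\alpha_n,\quad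 t_{n+1}:=T^*_{n+1},\quad m_{n+1}:=m^*_{n+1}+\Delta^*_n\alpha_{n+1}.$$ One has $0=T_0\le t_0<T_1\le t_1<T_2\le t_2<\cdots$ with $t_n\to+\infty$, so $\ell$ is well defined: on $[t_n,T_{n+1})$ it is the affine interpolation of the values $m_n$ at $t_n$ and $M_{n+1}$ at $T_{n+1}$; on $[T_n,t_n)$ (when $T_n<t_n$) it is the affine interpolation of the values $M_n$ at $T_n$ and $m_n$ at $t_n$; when $T_n=t_n$ the segment from $G_n$ to $g_n$ is vertical and $\ell(t_n)=m_n$. *)

(* Defs.v *)
From HB Require Import structures.
From mathcomp Require Import all_boot all_order all_algebra.
From mathcomp Require Import all_classical all_reals all_analysis.
Set Implicit Arguments.
Unset Strict Implicit.
Unset Printing Implicit Defensive.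
Import Order.TTheory GRing.Theory Num.Theory.
Import numFieldNormedType.Exports.
Local Open Scope classical_set_scope.
Local Open Scope ring_scope.

(** The recursion is run on the quadruple [(T_n, M_n, t_n, m_n)]; the names
    [seq_T] and [seq_M] stand for the upper-case sequences, [seq_t] and [seq_m]
    for the lower-case ones. *)
Record vertices (R : realType) := Vertices {
  vT : R; vM : R; vt : R; vm : R }.

Definition alpha (R : realType) (n : nat) : R := n.+1%:R^-1.

Definition delta (R : realType) (n : nat) : R := if n == 0%N then 1 else 0.

Definition next_vertices (R : realType) (n : nat) (v : vertices R) :
    vertices R :=
  let t' := vt v + vm v in
  let m' := vm v in
  let T' := vT v + vM v in
  let M' := vM v in
  let D := T' - t' in
  if D <= 0 then
    Vertices (T' + delta R n) (M' + 2 * delta R n) t' m'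
  else
    Vertices t' (M' - D * alpha R n) T' (m' + D * alpha R n.+1).

Fixpoint vertices_seq (R : realType) (n : nat) : vertices R :=
  if n is k.+1 then next_vertices k (vertices_seq R k)
  else Vertices 0 0 0 1.

Definition seq_T (R : realType) (n : nat) : R := vT (vertices_seq R n).
Definition seq_M (R : realType) (n : nat) : R := vM (vertices_seq R n).
Definition seq_t (R : realType) (n : nat) : R := vt (vertices_seq R n).
Definition seq_m (R : realType) (n : nat) : R := vm (vertices_seq R n).

Definition upper_vertex (R : realType) (n : nat) : R * R :=
  (seq_T R n, seq_M R n).
Definition lower_vertex (R : realType) (n : nat) : R * R :=
  (seq_t R n, seq_m R n).

Definition plane_segment (R : realType) (p q : R * R) : set (R * R) :=
  [set z | exists2 s : R, 0 <= s <= 1 &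
     z = ((1 - s) * p.1 + s * q.1, (1 - s) * p.2 + s * q.2)].

Definition polygonal_curve (R : realType) : set (R * R) :=
  \bigcup_(n in [set: nat])
    (plane_segment (upper_vertex R n) (lower_vertex R n) `|`
     plane_segment (lower_vertex R n) (upper_vertex R n.+1)).

(** Functions on [[0, +oo)] are represented by functions on [R] whose values at
    negative arguments are never used: the left limit is only taken at [t > 0].
    The last component is the initial vertical segment, at [t = 0]. *)
Definition generalized_graph (R : realType) (f : R -> R) : set (R * R) :=
  [set z | 0 <= z.1 /\ z.2 = f z.1] `|`
  [set z | 0 < z.1 /\
     exists l r : R,
       [/\ f x @[x --> z.1^'-] --> l, f x @[x --> z.1^'+] --> r, l != r &
           Num.min l r <= z.2 <= Num.max l r]] `|`
  [set z | z.1 = 0 /\ 0 <= z.2 <= 1].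

Definition right_continuous_nonneg (R : realType) (f : R -> R) : Prop :=
  forall t : R, 0 <= t -> f x @[x --> t^'+] --> f t.

Definition has_polygonal_graph (R : realType) (f : R -> R) : Prop :=
  [/\ (forall t : R, 0 <= t -> 0 <= f t),
      right_continuous_nonneg f &
      generalized_graph f = @polygonal_curve R].

Definition u0 (R : realType) (t : R) : R := \1_(`[0%R, 1%R[ : set R) t.

(* Main.v *)
Require Import Defs.
From HB Require Import structures.
From mathcomp Require Import all_boot all_order all_algebra.
From mathcomp Require Import all_classical all_reals all_analysis.
From mathcomp Require Import ring lra.
Set Implicit Arguments.
Unset Strict Implicit.
Unset Printing Implicit Defensive.
Import Order.TTheory GRing.Theory Num.Theory.
Import numFieldNormedType.Exports.
Local Open Scope classical_set_scope.
Local Open Scope ring_scope.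

(** Write phi(r) = r + ell(r). Substituting r = t - s, the measure in the
    equation is that of the set of times r in [0, t] with phi(r) > t, so the
    equation describes how phi transports the graph of ell. On each rising
    stretch [t_n, T_{n+1}) the slope of ell is alpha_n, hence phi is affine and
    increasing there, from phi(t_n) = t*_{n+1} to the left limit T*_{n+2} at
    T_{n+1}. The stretch [T_n, t_n) between an upper and a lower vertex (a
    downward jump when T_n = t_n) is sent affinely onto the segment between
    T*_{n+1} and t*_{n+1}, and the vertices of index n+1 satisfy
      T_{n+1} = min(T*_{n+1}, t*_{n+1}),  t_{n+1} = max(T*_{n+1}, t*_{n+1})
    for n >= 1. Everything rests on the ordering t_n < T_{n+1} <= t_{n+1}, which
    follows from the invariant 1 <= m_n, 0 < M_n - m_n <= 1,
    0 <= t_n - T_n <= 1 for n >= 1 ([vertices_invariant]).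

    The ordering localizes the condition phi(r) > t: phi <= t_{n+1} before t_n
    ([forward_le]) and phi >= T_{n+2} from T_{n+1} on ([forward_ge]), so for t
    in a given stretch only one to three stretches have to be examined.

    - For t in [t_{n+1}, T_{n+2}) the set is (r_0, t], where phi(r_0) = t and
      r_0 lies in [t_n, T_{n+1}) ([delay_rising]). Inverting 1 + alpha_n turns
      the slope alpha_n into alpha_n / (1 + alpha_n) = alpha_{n+1}.
    - For t in [T_{n+2}, t_{n+2}) with T*_{n+2} <= t*_{n+2}, phi is
      nondecreasing near the relevant times and the set is again some (r_0, t],
      now with r_0 between T_{n+1} and t_{n+1} ([delay_keep]).
    - For t in [T_{n+2}, t_{n+2}) with T*_{n+2} > t*_{n+2}, phi rises through t,
      falls back through t between T_{n+1} and t_{n+1}, and rises again; the set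
      is (r_1, r_2) together with (r_3, t] ([delay_swap]). The corrections
      Delta* alpha in the recursion are what makes its measure match the
      polygonal line.

    On [0, 1) phi exceeds t everywhere and the contribution of u_0 appears.

    What remains is the passage between the generalized graph and piecewise
    affine formulas: right continuity forces any function whose generalized
    graph is the polygonal line to agree with the affine interpolation on each
    half-open stretch, and conversely such an interpolation has that graph
    ([polygonal_graph_interpolatesP]). *)

(** * Polygonal lines and their interpolating functions *)

Section Polygon.
Variable R : realType.
Implicit Types (p q z : R * R) (t s : R) (f : R -> R).

Definition chord p q t : R :=
  p.2 + (t - p.1) / (q.1 - p.1) * (q.2 - p.2).

Lemma chord_left p q : chord p q p.1 = p.2.
Proof. by rewrite /chord subrr !mul0r addr0. Qed.

Lemma chord_right p q : p.1 < q.1 -> chord p q q.1 = q.2.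
Proof. by move=> pq; rewrite /chord divff ?subr_eq0 ?gt_eqF//; ring. Qed.

Lemma chord_affine p q s : p.1 < q.1 ->
  chord p q ((1 - s) * p.1 + s * q.1) = (1 - s) * p.2 + s * q.2.
Proof.
move=> pq; rewrite /chord.
by field; rewrite subr_eq0 gt_eqF.
Qed.

Lemma chord_param p q t : p.1 <= t < q.1 ->
  exists s, [/\ 0 <= s, s < 1, t = (1 - s) * p.1 + s * q.1 &
                chord p q t = (1 - s) * p.2 + s * q.2].
Proof.
move=> /andP[pt tq].
have pq : p.1 < q.1 by exact: le_lt_trans tq.
have d0 : 0 < q.1 - p.1 by rewrite subr_gt0.
have tE : t = (1 - (t - p.1) / (q.1 - p.1)) * p.1
              + (t - p.1) / (q.1 - p.1) * q.1.
  by field; rewrite gt_eqF.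
exists ((t - p.1) / (q.1 - p.1)); split => //.
- by rewrite divr_ge0 ?subr_ge0// ltW.
- by rewrite ltr_pdivrMr// mul1r ltrD2r.
- by rewrite [in LHS]tE chord_affine.
Qed.

Lemma continuous_chord p q : continuous (chord p q).
Proof.
move=> t; rewrite /chord.
apply: cvgD; first exact: cvg_cst.
apply: cvgMr_tmp; apply: cvgMr_tmp; apply: cvgB; [exact: cvg_id|exact: cvg_cst].
Qed.

Lemma plane_segment_fst p q z : p.1 <= q.1 -> plane_segment p q z ->
  p.1 <= z.1 <= q.1.
Proof. move=> pq [s s01 ->] /=; nra. Qed.

Lemma plane_segmentP p q z : p.1 < q.1 ->
  plane_segment p q z <-> p.1 <= z.1 <= q.1 /\ z.2 = chord p q z.1.
Proof.
move=> pq; split=> [zpq|].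
  split; first exact: plane_segment_fst (ltW pq) zpq.
  by case: zpq => s _ -> /=; rewrite chord_affine.
case: z => a b /= [/andP[pa]]; rewrite le_eqVlt => /predU1P[->|aq] ->.
  exists 1; first by rewrite lexx ler01.
  by rewrite chord_right//; congr pair; ring.
have [|s [s0 s1 aE ->]] := @chord_param p q a; first by rewrite pa.
by exists s; rewrite ?s0 ?ltW// -aE.
Qed.

(** A vertical segment is exactly what the generalized graph adds at a jump
    between the values [p.2] and [q.2]. *)
Lemma plane_segment_verticalP p q z : p.1 = q.1 ->
  plane_segment p q z <->
  z.1 = p.1 /\ Num.min p.2 q.2 <= z.2 <= Num.max p.2 q.2.
Proof.
move=> pq; split=> [[s s01 ->] /=|].
  split; first by rewrite -pq; ring.
  by case: (leP p.2 q.2) => h; nra.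
case: z => a b /= [-> ab]; have [pqE|pq2] := eqVneq p.2 q.2.
  exists 0; first by rewrite lexx ler01.
  move: ab; rewrite -pqE minxx maxxx -eq_le => /eqP <-.
  by congr pair; ring.
exists ((b - p.2) / (q.2 - p.2)).
  move: ab; case: (ltgtP p.2 q.2) pq2 => // h _ /andP[b1 b2].
    by rewrite divr_ge0 ?ler_pdivrMr ?mul1r//; lra.
  rewrite -mulrNN -invrN !opprB.
  by rewrite divr_ge0 ?ler_pdivrMr ?mul1r//; lra.
rewrite -pq; congr pair; first by ring.
by field; rewrite subr_eq0 eq_sym.
Qed.

Variable p : nat -> R * R.

(** Half-open pieces: a piece with equal abscissae imposes nothing, so at a
    vertical edge the value comes from the next edge, in accordance with right
    continuity. *)
Definition interpolates f : Prop := forall k t,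
  (p k).1 <= t < (p k.+1).1 -> f t = chord (p k) (p k.+1) t.

Hypothesis p_homo : forall k, (p k).1 <= (p k.+1).1.

Let p_le j k : (j <= k)%N -> (p j).1 <= (p k).1.
Proof.
by move=> jk; apply: (@homo_leq _ (fun k => (p k).1) <=%R) jk => // ? ? ?;
  exact: le_trans.
Qed.

Lemma piece_leq j k t : (p j).1 <= t -> t < (p k).1 -> (j < k)%N.
Proof.
move=> jt tk; rewrite ltnNge; apply/negP => /p_le.
by rewrite leNgt (le_lt_trans jt tk).
Qed.

Lemma piece_uniq j k t :
  (p j).1 <= t < (p j.+1).1 -> (p k).1 <= t < (p k.+1).1 -> j = k.
Proof.
move=> /andP[j1 j2] /andP[k1 k2]; apply/eqP.
have := piece_leq j1 k2; have := piece_leq k1 j2.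
by rewrite !ltnS eqn_leq => -> ->.
Qed.

Lemma interpolant_exists : exists f, interpolates f.
Proof.
have /choice[f Hf] : forall t, exists y, forall k,
    (p k).1 <= t < (p k.+1).1 -> y = chord (p k) (p k.+1) t.
  move=> t; case: (pselect (exists k, (p k).1 <= t < (p k.+1).1)).
    move=> [k kt]; exists (chord (p k) (p k.+1) t) => j jt.
    by rewrite (piece_uniq jt kt).
  by move=> no; exists 0 => k kt; case: no; exists k.
by exists f => k t; exact: Hf.
Qed.

Hypothesis p_unbounded : forall t, exists k, t < (p k).1.

Lemma piece_exists t : (p 0%N).1 <= t -> exists k, (p k).1 <= t < (p k.+1).1.
Proof.
move=> t0; case: (ex_minnP (p_unbounded t)) => -[|k] tk kmin.
  by move: t0; rewrite leNgt tk.
exists k; rewrite tk andbT leNgt; apply/negP => /kmin.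
by rewrite ltnn.
Qed.

Lemma piece_exists_left t : (p 0%N).1 < t ->
  exists k, (p k).1 < t <= (p k.+1).1.
Proof.
move=> t0.
have ext : exists k, t <= (p k).1.
  by have [k /ltW] := p_unbounded t; exists k.
case: (ex_minnP ext) => -[|k] tk kmin.
  by move: t0; rewrite ltNge tk.
exists k; rewrite tk andbT ltNge; apply/negP => /kmin.
by rewrite ltnn.
Qed.

Lemma cvg_interpolant_right f k t : interpolates f ->
  (p k).1 <= t < (p k.+1).1 -> f x @[x --> t^'+] --> chord (p k) (p k.+1) t.
Proof.
move=> fp /andP[kt tk].
have : chord (p k) (p k.+1) x @[x --> t^'+] --> chord (p k) (p k.+1) t.
  exact: cvg_at_right_filter (@continuous_chord _ _ t).
apply: cvg_trans; apply: near_eq_cvg; near=> x.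
rewrite (fp k)//; apply/andP; split; last by near: x; exact: nbhs_right_lt.
by apply: (le_trans kt); near: x; exact: nbhs_right_ge.
Unshelve. all: by end_near. Qed.

Lemma cvg_interpolant_left f k t : interpolates f ->
  (p k).1 < t <= (p k.+1).1 -> f x @[x --> t^'-] --> chord (p k) (p k.+1) t.
Proof.
move=> fp /andP[kt tk].
have : chord (p k) (p k.+1) x @[x --> t^'-] --> chord (p k) (p k.+1) t.
  exact: cvg_at_left_filter (@continuous_chord _ _ t).
apply: cvg_trans; apply: near_eq_cvg; near=> x.
rewrite (fp k)//; apply/andP; split.
  by apply/ltW; near: x; exact: nbhs_left_gt.
by apply: lt_le_trans tk; near: x; exact: nbhs_left_lt.
Unshelve. all: by end_near. Qed.

Definition polyline : set (R * R) :=
  \bigcup_(k in [set: nat]) plane_segment (p k) (p k.+1).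

Lemma polyline_chord k z : polyline z -> (p k).1 < z.1 < (p k.+1).1 ->
  z.2 = chord (p k) (p k.+1) z.1.
Proof.
move=> [j _ zj] /andP[kz zk].
have /andP[jz zj1] := plane_segment_fst (p_homo j) zj.
have jk : j = k.
  apply/eqP; rewrite eqn_leq; have := piece_leq jz zk; rewrite ltnS => -> /=.
  rewrite leqNgt; apply/negP => /p_le.
  by rewrite leNgt (lt_le_trans kz zj1).
move: zj; rewrite jk; case/plane_segmentP => //.
exact: lt_trans kz zk.
Qed.

(** Inside a non-vertical edge the fibre of the line over an abscissa is a
    single point, which fixes [f]; at the left vertex, where a vertical edge may
    end, the value is recovered as a right limit. *)
Lemma polygonal_graph_interpolates f : right_continuous_nonneg f ->
  0 <= (p 0%N).1 -> generalized_graph f = polyline -> interpolates f.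
Proof.
move=> rcf p0 fp k t /andP[kt tk].
have t0 : 0 <= t by apply: le_trans kt; apply: (le_trans p0); exact: p_le.
apply: (norm_cvg_unique (rcf t t0)).
have : chord (p k) (p k.+1) x @[x --> t^'+] --> chord (p k) (p k.+1) t.
  exact: cvg_at_right_filter (@continuous_chord _ _ t).
apply: cvg_trans; apply: near_eq_cvg; near=> x.
have tx : t < x by near: x; exact: nbhs_right_gt.
apply/esym/(@polyline_chord k (x, f x)) => /=.
  by rewrite -fp; left; left; split => //=; apply: le_trans (ltW tx).
rewrite (le_lt_trans kt tx) /=; near: x; exact: nbhs_right_lt.
Unshelve. all: by end_near. Qed.

Hypothesis p0E : p 0%N = (0, 0).
Hypothesis p1E : p 1%N = (0, 1).
Hypothesis p_lt2 : forall k, (p k).1 < (p k.+2).1.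
Hypothesis p_vertical : forall k, (p k).1 = (p k.+1).1 -> (p k).2 != (p k.+1).2.
Hypothesis p_ge0 : forall k, 0 <= (p k).2.

Lemma interpolates_vertex f k : interpolates f ->
  (p k).1 < (p k.+1).1 -> f (p k).1 = (p k).2.
Proof. by move=> fp kk; rewrite (fp k) ?lexx// chord_left. Qed.

(** Since no two consecutive edges are vertical, the neighbours of a vertical
    edge supply the one-sided limits, which are the ends of that edge. The index
    is a successor because the vertical edge at the origin has no left
    neighbour. *)
Lemma interpolates_jump f k : interpolates f -> (p k.+1).1 = (p k.+2).1 ->
  f x @[x --> (p k.+1).1^'-] --> (p k.+1).2 /\
  f x @[x --> (p k.+1).1^'+] --> (p k.+2).2.
Proof.
move=> fp kk; have lt1 := p_lt2 k; have lt2 := p_lt2 k.+1; split.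
  rewrite -[X in _ --> X](@chord_right (p k)) ?kk//.
  by rewrite -kk; apply: (@cvg_interpolant_left f k) => //; rewrite kk lt1 /=.
rewrite kk -[X in _ --> X](@chord_left _ (p k.+3)).
by apply: cvg_interpolant_right => //; rewrite lexx -kk.
Qed.

(** A point where the one-sided limits differ cannot be interior to an edge nor
    a vertex between two non-vertical edges, so jumps correspond exactly to
    vertical edges; the vertical edge at the origin is the initial segment
    included by convention. *)
Lemma interpolates_polygonal_graph f : interpolates f ->
  generalized_graph f = polyline.
Proof.
move=> fp; apply/seteqP; split => -[t y].
  move=> [[[/= t0 ->]|[/= t0 [l [r [fl fr lr yb]]]]]|[/= -> y01]].
  - have [|k kt] := @piece_exists t; first by rewrite p0E.
    exists k => //; apply/plane_segmentP => /=.
      by case/andP: kt; exact: le_lt_trans.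
    by split; [case/andP: kt => -> /ltW|exact: fp].
  (* [j] carries the limit from the left and [k] the one from the right. *)
  - have [|j jt] := @piece_exists_left t; first by rewrite p0E.
    have [|k kt] := @piece_exists t; first by rewrite p0E ltW.
    have lE : l = chord (p j) (p j.+1) t.
      by apply: (norm_cvg_unique fl); exact: cvg_interpolant_left.
    have rE : r = chord (p k) (p k.+1) t.
      by apply: (norm_cvg_unique fr); exact: cvg_interpolant_right.
    case/andP: (jt) => j1; rewrite le_eqVlt => /predU1P[tE|j2]; last first.
      have jk : j = k by apply: (@piece_uniq j k t) kt; rewrite ltW.
      by move: lr; rewrite lE rE jk eqxx.
    have {}lE : l = (p j.+1).2.
      by rewrite lE tE chord_right// -tE.
    have := p_homo j.+1; rewrite le_eqVlt => /predU1P[vert|jj]; last first.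
      have jk : j.+1 = k by apply: (@piece_uniq j.+1 k t) kt; rewrite tE lexx.
      by move: lr; rewrite lE rE -jk tE chord_left eqxx.
    have {}rE : r = (p j.+2).2.
      apply: (norm_cvg_unique fr).
      by rewrite tE; case: (interpolates_jump fp vert).
    exists j.+1 => //; apply/plane_segment_verticalP => //=.
    by rewrite -lE -rE.
  - exists 0%N => //; apply/plane_segment_verticalP; rewrite p0E p1E//=.
    by rewrite min_l ?max_r ?ler01.
move=> [k _]; have := p_homo k; rewrite le_eqVlt => /predU1P[vert|kk].
  case/(plane_segment_verticalP _ vert) => /= -> yb.
  case: k vert yb => [|k] vert yb.
    right; rewrite p0E p1E/= in yb *; split => //.
    by move: yb; rewrite min_l ?max_r ?ler01.
  left; right => /=; split.
    rewrite vert; apply: le_lt_trans (p_lt2 k).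
    by have := p_le (leq0n k); rewrite p0E.
  have [fl fr] := interpolates_jump fp vert.
  exists (p k.+1).2, (p k.+2).2; split => //; exact: p_vertical.
case/(plane_segmentP _ kk) => /= /andP[kt] + ->.
have t0 : 0 <= t by apply: le_trans kt; have := p_le (leq0n k); rewrite p0E.
rewrite le_eqVlt => /predU1P[tE|tk]; last first.
  by left; left; split => //=; rewrite (fp k)// kt.
rewrite tE chord_right//.
have := p_homo k.+1; rewrite le_eqVlt => /predU1P[vert|kk1].
  left; right; split => /=.
    by apply: le_lt_trans kk; have := p_le (leq0n k); rewrite p0E.
  have [fl fr] := interpolates_jump fp vert.
  exists (p k.+1).2, (p k.+2).2; split => //; first exact: p_vertical.
  by rewrite ge_min le_max !lexx.
left; left; split => /=; first by rewrite -tE.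
by rewrite interpolates_vertex.
Qed.

Lemma interpolates_ge0 f t : interpolates f -> 0 <= t -> 0 <= f t.
Proof.
move=> fp t0; have [|k kt] := @piece_exists t; first by rewrite p0E.
have [s [s0 s1 _]] := chord_param kt; rewrite (fp k)// => ->.
by rewrite addr_ge0// mulr_ge0// subr_ge0 ltW.
Qed.

Lemma interpolates_right_continuous f : interpolates f ->
  right_continuous_nonneg f.
Proof.
move=> fp t t0; have [|k kt] := @piece_exists t; first by rewrite p0E.
by rewrite (fp k)//; exact: cvg_interpolant_right.
Qed.

End Polygon.

(** * The vertex recursion *)

Section Vertices.
Variable R : realType.
Local Notation T := (@seq_T R).
Local Notation M := (@seq_M R).
Local Notation t := (@seq_t R).
Local Notation m := (@seq_m R).
Local Notation alpha := (@alpha R).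
Implicit Types (x r s : R).

Lemma alpha_gt0 n : 0 < alpha n.
Proof. by rewrite invr_gt0 ltr0n. Qed.

(** The inverse of [r |-> r + alpha n * r] is [x |-> x - alpha n.+1 * x]: the
    slope [alpha n] is transported to [alpha n.+1]. *)
Lemma alpha_recursion n : (1 + alpha n) * (1 - alpha n.+1) = 1.
Proof.
rewrite /Defs.alpha -[n.+2]addn1 -[n.+1]addn1 !natrD.
have n0 : 0 <= n%:R :> R by exact: ler0n.
by field; apply/andP; split; apply/lt0r_neq0; lra.
Qed.

Lemma vertices1 : [/\ T 1 = 1, M 1 = 2, t 1 = 1 & m 1 = 1].
Proof.
rewrite /seq_T /seq_M /seq_t /seq_m /= /next_vertices /delta /=.
have -> : (0 + 0 - (0 + 1) <= 0 :> R) by lra.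
by split=> /=; ring.
Qed.

Lemma vertices_keep n : T n.+1 + M n.+1 <= t n.+1 + m n.+1 ->
  [/\ T n.+2 = T n.+1 + M n.+1, M n.+2 = M n.+1,
      t n.+2 = t n.+1 + m n.+1 & m n.+2 = m n.+1].
Proof.
rewrite /seq_T /seq_M /seq_t /seq_m [vertices_seq R n.+2]/=.
rewrite {1 3 5 7}/next_vertices /delta => D; rewrite subr_le0 D /=.
by rewrite mulr0 !addr0.
Qed.

Lemma vertices_swap n : t n.+1 + m n.+1 < T n.+1 + M n.+1 ->
  let D := T n.+1 + M n.+1 - (t n.+1 + m n.+1) in
  [/\ T n.+2 = t n.+1 + m n.+1, M n.+2 = M n.+1 - D * alpha n.+1,
      t n.+2 = T n.+1 + M n.+1 & m n.+2 = m n.+1 + D * alpha n.+2].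
Proof.
rewrite /seq_T /seq_M /seq_t /seq_m [vertices_seq R n.+2]/=.
rewrite {1 3 5 7}/next_vertices => D.
by rewrite subr_le0 leNgt D /=.
Qed.

(** The gap [M - m] stays positive because the swap at step [n.+1] happens only
    with [D <= M - m], and it removes [D * (alpha n.+1 + alpha n.+2)], where
    the two alphas sum to at most [1 / 2 + 1 / 3]. The distance [t - T] either
    decreases by the gap or becomes [D]. *)
Lemma vertices_invariant n :
  [/\ 1 <= m n.+1, 0 < M n.+1 - m n.+1 <= 1 & 0 <= t n.+1 - T n.+1 <= 1].
Proof.
elim: n => [|n [m1 /andP[e0 e1] /andP[d0 d1]]].
  by case: vertices1 => -> -> -> ->; split; lra.
case: (leP (T n.+1 + M n.+1) (t n.+1 + m n.+1)) => D.
  by case: (vertices_keep D) => -> -> -> ->; split; lra.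
case: (vertices_swap D) => -> -> -> ->.
have a1 : alpha n.+1 <= 1 / 2.
  by rewrite /Defs.alpha div1r lef_pV2 ?posrE ?ltr0n// ler_nat.
have a2 : alpha n.+2 <= 1 / 3.
  by rewrite /Defs.alpha div1r lef_pV2 ?posrE ?ltr0n// ler_nat.
have := alpha_gt0 n.+1; have := alpha_gt0 n.+2; split; nra.
Qed.

Lemma T_next n : T n.+2 = Num.min (T n.+1 + M n.+1) (t n.+1 + m n.+1).
Proof.
case: (leP (T n.+1 + M n.+1) (t n.+1 + m n.+1)) => D.
  by case: (vertices_keep D).
by case: (vertices_swap D).
Qed.

Lemma t_next n : t n.+2 = Num.max (T n.+1 + M n.+1) (t n.+1 + m n.+1).
Proof.
case: (leP (T n.+1 + M n.+1) (t n.+1 + m n.+1)) => D.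
  by case: (vertices_keep D).
by case: (vertices_swap D).
Qed.

Lemma m_ge1 n : 1 <= m n.
Proof. by case: n => // n; case: (vertices_invariant n). Qed.

Lemma T_le_t n : T n <= t n.
Proof. by case: n => // n; case: (vertices_invariant n); lra. Qed.

(** Both candidates [T + M] and [t + m] for the next upper abscissa exceed [t],
    since [t - T <= 1 <= m < M]. *)
Lemma t_lt_T n : t n < T n.+1.
Proof.
case: n => [|n]; first by case: vertices1 => -> _ _ _; exact: ltr01.
rewrite T_next lt_min; case: (vertices_invariant n).
by move=> m1 e d; apply/andP; split; lra.
Qed.

Lemma t_homo j k : (j <= k)%N -> t j <= t k.
Proof.
by move=> jk; apply: (@homo_leq _ t <=%R) jk => // [? ? ?|i];
  [exact: le_trans|exact: le_trans (ltW (t_lt_T i)) (T_le_t _)].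
Qed.

Lemma T_homo j k : (j <= k)%N -> T j <= T k.
Proof.
by move=> jk; apply: (@homo_leq _ T <=%R) jk => // [? ? ?|i];
  [exact: le_trans|exact: le_trans (T_le_t _) (ltW (t_lt_T i))].
Qed.

Lemma t_ge_nat n : n%:R <= t n.
Proof.
elim: n => // n IH; rewrite -natr1; case: n IH => [|n] IH.
  by case: vertices1 => _ _ -> _; rewrite add0r.
rewrite t_next le_max; have := m_ge1 n.+1.
by move=> m1; apply/orP; right; lra.
Qed.

Lemma t_next_ge n : t n + m n <= t n.+1.
Proof.
case: n => [|n]; first by case: vertices1 => _ _ -> _; rewrite add0r.
by rewrite t_next le_max lexx orbT.
Qed.

Lemma t_next_ge_T n : T n + M n <= t n.+1.
Proof.
case: n => [|n]; first by case: vertices1 => _ _ -> _; rewrite add0r ler01.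
by rewrite t_next le_max lexx.
Qed.

Lemma T_next_le n : T n.+1 <= t n + m n.
Proof.
case: n => [|n]; first by case: vertices1 => -> _ _ _; rewrite add0r.
by rewrite T_next ge_min lexx orbT.
Qed.

Lemma T_next_le_T n : T n.+2 <= T n.+1 + M n.+1.
Proof. by rewrite T_next ge_min lexx. Qed.

(** Whether or not a swap occurs, the new lower vertex lies on the line of slope
    [alpha n.+1] through [(t n + m n, m n)]; similarly for the upper one in
    [M_shift]. *)
Lemma m_shift n : m n.+1 = m n + alpha n.+1 * (t n.+1 - (t n + m n)).
Proof.
case: n => [|n].
  by case: vertices1 => _ _ -> ->; rewrite /seq_m /seq_t /=; ring.
case: (leP (T n.+1 + M n.+1) (t n.+1 + m n.+1)) => D.
  by case: (vertices_keep D) => _ _ -> ->; ring.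
by case: (vertices_swap D) => _ _ -> ->; ring.
Qed.

Lemma M_shift n :
  M n.+2 = M n.+1 + alpha n.+1 * (T n.+2 - (T n.+1 + M n.+1)).
Proof.
case: (leP (T n.+1 + M n.+1) (t n.+1 + m n.+1)) => D.
  by case: (vertices_keep D) => -> -> _ _; ring.
by case: (vertices_swap D) => -> -> _ _; ring.
Qed.

(** By [m_shift] and [M_shift], the next rising edge is carried by the line
    joining the images of the previous lower and upper vertices under
    [(x, y) |-> (x + y, y)]; that shear takes slope [alpha n] to
    [alpha n.+1]. *)
Lemma rising_slope n : M n.+1 = m n + alpha n * (T n.+1 - t n).
Proof.
elim: n => [|n IH].
  case: vertices1 => -> -> _ _.
  by rewrite /Defs.alpha /seq_m /seq_t /= invr1; ring.
rewrite M_shift m_shift IH.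
have E : alpha n.+1 * (1 + alpha n) = alpha n.
  by have := alpha_recursion n; lra.
by rewrite -{1}E; ring.
Qed.

(** * The polygonal line of the recursion *)

Definition vertex k : R * R :=
  if odd k then lower_vertex R k./2 else upper_vertex R k./2.

Lemma vertex_double n : vertex n.*2 = upper_vertex R n.
Proof. by rewrite /vertex odd_double doubleK. Qed.

Lemma vertex_doubleS n : vertex n.*2.+1 = lower_vertex R n.
Proof. by rewrite /vertex /= odd_double uphalf_double. Qed.

Lemma edge_ind (P : R * R -> R * R -> Prop) :
  (forall n, P (upper_vertex R n) (lower_vertex R n)) ->
  (forall n, P (lower_vertex R n) (upper_vertex R n.+1)) ->
  forall k, P (vertex k) (vertex k.+1).
Proof.
move=> Peven Podd k; rewrite -[k]odd_double_half; case: (odd k).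
  by rewrite add1n -doubleS vertex_doubleS vertex_double.
by rewrite add0n vertex_double vertex_doubleS.
Qed.

Lemma polyline_vertex : polyline vertex = @polygonal_curve R.
Proof.
apply/seteqP; split=> z.
  move=> [k _]; move: k.
  apply: (edge_ind
    (P := fun p q => plane_segment p q z -> polygonal_curve z)) => n zn.
    by exists n => //; left.
  by exists n => //; right.
move=> [n _ [zn|zn]].
  by exists n.*2 => //; rewrite vertex_double vertex_doubleS.
by exists n.*2.+1 => //; rewrite -doubleS vertex_double vertex_doubleS.
Qed.

Lemma vertex_homo k : (vertex k).1 <= (vertex k.+1).1.
Proof.
apply: (edge_ind (P := fun p q => p.1 <= q.1)) => n /=; first exact: T_le_t.
exact/ltW/t_lt_T.
Qed.

Lemma vertex_lt2 k : (vertex k).1 < (vertex k.+2).1.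
Proof.
have [] : (vertex k).1 < (vertex k.+1).1 \/ (vertex k.+1).1 < (vertex k.+2).1.
- rewrite -[k]odd_double_half; case: (odd k).
    by left; rewrite add1n -doubleS vertex_doubleS vertex_double; exact: t_lt_T.
  by right; rewrite add0n -doubleS vertex_doubleS vertex_double; exact: t_lt_T.
- by move=> /lt_le_trans; apply; exact: vertex_homo.
- exact/le_lt_trans/vertex_homo.
Qed.

Lemma vertex_unbounded x : exists k, x < (vertex k).1.
Proof.
exists (Num.truncn x).+1.*2.+1; rewrite vertex_doubleS /=.
by apply: lt_le_trans (t_ge_nat _); exact: truncnS_gt.
Qed.

Lemma upper_gt_lower n : m n.+1 < M n.+1.
Proof. by case: (vertices_invariant n) => _ /andP[]; rewrite subr_gt0. Qed.

Lemma M_ge0 n : 0 <= M n.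
Proof.
by case: n => // n; have := upper_gt_lower n; have := m_ge1 n.+1; lra.
Qed.

Lemma vertex_vertical k :
  (vertex k).1 = (vertex k.+1).1 -> (vertex k).2 != (vertex k.+1).2.
Proof.
apply: (edge_ind (P := fun p q => p.1 = q.1 -> p.2 != q.2)) => n /= E.
  case: n {E} => [|n]; first by rewrite eq_sym oner_eq0.
  by rewrite gt_eqF// upper_gt_lower.
by have := t_lt_T n; rewrite E ltxx.
Qed.

Lemma vertex_ge0 k : 0 <= (vertex k).2.
Proof.
apply: (edge_ind (P := fun p _ => 0 <= p.2)) => n /=; first exact: M_ge0.
by apply: le_trans (m_ge1 n); exact: ler01.
Qed.

(** The problem reduces to the interpolating functions: this gives existence and
    replaces the graph condition by explicit formulas. *)
Lemma polygonal_graph_interpolatesP f :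
  has_polygonal_graph f <-> interpolates vertex f.
Proof.
have v0 : vertex 0 = (0, 0) by [].
have v1 : vertex 1 = (0, 1) by [].
rewrite /has_polygonal_graph -polyline_vertex; split=> [[_ rcf gf]|fv].
  by apply: polygonal_graph_interpolates rcf _ gf; [exact: vertex_homo|].
split.
- move=> x x0; apply: interpolates_ge0 fv x0 => //.
  + exact: vertex_unbounded.
  + exact: vertex_ge0.
- apply: interpolates_right_continuous fv => //; exact: vertex_unbounded.
- apply: interpolates_polygonal_graph fv => //.
  + exact: vertex_homo.
  + exact: vertex_unbounded.
  + exact: vertex_lt2.
  + exact: vertex_vertical.
Qed.

(** * The delay equation on each stretch *)

Section Interpolant.
Variable ell : R -> R.
Hypothesis ellP : interpolates vertex ell.

Local Notation delay_measure x :=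
  (lebesgue_measure [set s : R | (0 <= s <= x)%R /\ (s < ell (x - s))%R]).

Lemma ell_rising n r : t n <= r < T n.+1 -> ell r = m n + alpha n * (r - t n).
Proof.
move=> nr; have := @ellP n.*2.+1 r.
rewrite -doubleS vertex_double vertex_doubleS => ->//.
rewrite /chord /= rising_slope; have := t_lt_T n => tT.
by field; rewrite subr_eq0 gt_eqF.
Qed.

Lemma ell_between n r : T n <= r < t n -> exists s,
  [/\ 0 <= s, s < 1, r = (1 - s) * T n + s * t n &
      ell r = (1 - s) * M n + s * m n].
Proof.
move=> nr; have := @ellP n.*2 r; rewrite vertex_double vertex_doubleS.
by move=> ->//; exact: (@chord_param _ (upper_vertex R n) (lower_vertex R n)).
Qed.

Lemma rising_or_between r : 0 <= r ->
  exists n, t n <= r < T n.+1 \/ T n <= r < t n.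
Proof.
move=> r0; have [//|k] := @piece_exists R vertex vertex_unbounded r.
move: k; apply: (edge_ind (P := fun p q => p.1 <= r < q.1 -> _)) => n rn.
  by exists n; right.
by exists n; left.
Qed.

(** On each stretch [r + ell r] stays between its values at the two ends, so
    only the vertices matter: the largest image of a vertex up to [t n] is
    [t n.+1]. *)
Lemma forward_le n r : 0 <= r -> r < t n -> r + ell r <= t n.+1.
Proof.
move=> r0 rn; have [k [kr|kr]] := rising_or_between r0.
  have kn : (k < n)%N.
    rewrite ltnNge; apply/negP => /t_homo; case/andP: kr; lra.
  rewrite (ell_rising kr).
  have := rising_slope k; have := alpha_gt0 k.
  have := t_next_ge_T k.+1; have := t_homo kn; have := @t_homo k.+2 n.+1 kn.
  case/andP: kr; nra.
have kn : (k <= n)%N.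
  rewrite leqNgt; apply/negP => /T_homo; have := t_lt_T n.
  case/andP: kr; lra.
have := t_next_ge_T k; have := t_next_ge k; have := @t_homo k.+1 n.+1 kn.
have [s [s0 s1 -> ->]] := ell_between kr; nra.
Qed.

(** Dually, the smallest image of a vertex from [T n.+1] on is [T n.+2]. *)
Lemma forward_ge n r : T n.+1 <= r -> T n.+2 <= r + ell r.
Proof.
move=> rn.
have r0 : 0 <= r by apply: le_trans rn; exact: (@T_homo 0).
have [k [kr|kr]] := rising_or_between r0.
  have kn : (n < k)%N.
    rewrite ltnNge -ltnS; apply/negP => /T_homo; case/andP: kr; lra.
  rewrite (ell_rising kr).
  have := alpha_gt0 k.
  have := T_next_le k; have := @T_homo n.+2 k.+1 kn.
  case/andP: kr; nra.
have kn : (n < k)%N.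
  rewrite ltnNge; apply/negP => /t_homo; have := t_lt_T n.
  case/andP: kr; lra.
case: k kn kr => // k kn kr.
have := T_next_le_T k; have := T_next_le k.+1; have := @T_homo n.+2 k.+2 kn.
have [s [s0 s1 -> ->]] := ell_between kr; nra.
Qed.

(** The substitution [r = x - s] carries the times [r] with [x < r + ell r] to
    the set being measured. *)
Lemma measure_two_pieces (x r1 r2 r3 : R) : 0 <= r1 -> r1 <= r2 -> r2 <= r3 ->
  r3 <= x ->
  (forall r : R, 0 <= r <= x -> (x < r + ell r <-> r1 < r < r2 \/ r3 < r)) ->
  delay_measure x = ((x - r3) + (r2 - r1))%:E.
Proof.
move=> r10 r12 r23 r3x H.
have -> : [set s : R | (0 <= s <= x)%R /\ (s < ell (x - s))%R] =
    `[0, x - r3[%classic `|` `]x - r2, x - r1[%classic.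
  apply/seteqP; split=> s /=; rewrite !in_itv /=.
    move=> [sx sl].
    have /H[+ _] : 0 <= x - s <= x by lra.
    by case=> [|h|h]; [lra|right; lra|left; lra].
  move=> h; have sx : 0 <= s <= x by case: h => h; lra.
  split => //; have /H[_] : 0 <= x - s <= x by lra.
  move=> H'; suff : x < x - s + ell (x - s) by lra.
  by apply: H'; case: h => h; [right; lra|left; lra].
transitivity (lebesgue_measure (`[0%R, (x - r3)%R[%classic : set R) +
              lebesgue_measure (`](x - r2)%R, (x - r1)%R[%classic : set R))%E.
  apply: measureU => //.
  by apply/seteqP; split=> s //= []; rewrite !in_itv /=; lra.
rewrite !lebesgue_measure_itv /= !lte_fin [RHS]EFinD; congr (_ + _)%E.
  case: ltP => h; first by rewrite -EFinB subr0.
  by congr EFin; lra.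
case: ltP => h; first by rewrite -EFinB; congr EFin; ring.
by congr EFin; lra.
Qed.

Lemma measure_tail (x r0 : R) : 0 <= r0 <= x ->
  (forall r : R, 0 <= r <= x -> (x < r + ell r <-> r0 < r)) ->
  delay_measure x = (x - r0)%:E.
Proof.
move=> /andP[r00 r0x] H; rewrite (@measure_two_pieces x r0 r0 r0)//.
  by congr EFin; ring.
by move=> r rx; rewrite H//; split=> [|[]//]; [right|lra].
Qed.

(** On the first stretch [r + ell r = 1 + 2 * r] exceeds every [x < 1], so all
    of [[0, x]] counts. *)
Lemma delay_first x : 0 <= x < 1 ->
  delay_measure x = (ell x - 1)%:E.
Proof.
move=> /andP[x0 x1].
have ellE r : 0 <= r < 1 -> ell r = 1 + r.
  move=> r01; rewrite (@ell_rising 0); last by case: vertices1 => ->.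
  by rewrite /Defs.alpha invr1 mul1r subr0.
have -> : [set s : R | (0 <= s <= x)%R /\ (s < ell (x - s))%R] =
    `[0, x]%classic.
  apply/seteqP; split=> s /=; rewrite in_itv /=; first by case.
  by move=> sx; split => //; rewrite ellE; lra.
rewrite lebesgue_measure_itv /= lte_fin ellE ?x0//.
case: ltP => h; first by rewrite -EFinB; congr EFin; ring.
by congr EFin; lra.
Qed.

(** The solution [r] of [r + ell r = x] on the rising line through
    [(t n, m n)], the factor [1 - alpha n.+1] being the inverse of
    [1 + alpha n]. *)
Definition rising_preimage n (x : R) :=
  t n + (x - (t n + m n)) * (1 - alpha n.+1).

Lemma rising_crossing n (x r : R) : t n <= r < T n.+1 ->
  (x < r + ell r) = (rising_preimage n x < r).
Proof.
move=> nr; rewrite (ell_rising nr) /rising_preimage.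
have := alpha_recursion n; have := alpha_gt0 n.
set a := alpha n; set b := alpha n.+1 => a0 ab.
have E : r + (m n + a * (r - t n)) - x =
   (1 + a) * (r - (t n + (x - (t n + m n)) * (1 - b))).
  transitivity ((1 + a) * (r - t n)
      - (x - (t n + m n)) * ((1 + a) * (1 - b))); last by ring.
  by rewrite ab; ring.
by rewrite -subr_gt0 E pmulr_rgt0 ?subr_gt0//; lra.
Qed.

Lemma rising_preimage_bounds n x : t n + m n <= x -> x < T n.+1 + M n.+1 ->
  t n <= rising_preimage n x < T n.+1.
Proof.
rewrite rising_slope /rising_preimage => x1 x2.
have := alpha_recursion n; have := alpha_gt0 n.
set a := alpha n in x2 *; set b := alpha n.+1 => a0 ab.
have b1 : 0 < 1 - b by nra.
apply/andP; split; nra.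
Qed.

(** Here the solution [r0] of [r + ell r = x] lies on the previous rising
    stretch; everything later exceeds [x] and nothing earlier does. *)
Lemma delay_rising n x : t n.+1 <= x < T n.+2 ->
  delay_measure x = (ell x)%:E.
Proof.
move=> nx; case/andP: (nx) => x1 x2.
have /andP[p1 p2] : t n <= rising_preimage n x < T n.+1.
  apply: rising_preimage_bounds; first exact: le_trans (t_next_ge n) x1.
  exact: lt_le_trans x2 (T_next_le_T n).
have tn0 : 0 <= t n by exact: (@t_homo 0).
have Tt := T_le_t n.+1.
rewrite (@measure_tail x (rising_preimage n x)).
- rewrite (ell_rising nx) /rising_preimage m_shift; congr EFin; ring.
- by apply/andP; split; lra.
- move=> r /andP[r0 rx]; have [rt|tr] := ltP r (t n).
    by have := forward_le r0 rt; split; lra.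
  have [rT|Tr] := ltP r (T n.+1).
    by rewrite (@rising_crossing n)// ?tr.
  have := forward_ge Tr; split; lra.
Qed.

(** Without a swap, [r + ell r] is increasing from [T n.+1] to [t n.+1] and maps
    the point dividing these in the ratio given by [s] to the point dividing
    [T n.+2] and [t n.+2] in the same ratio. *)
Lemma delay_keep n x : T n.+1 + M n.+1 <= t n.+1 + m n.+1 ->
  T n.+2 <= x < t n.+2 ->
  delay_measure x = (ell x)%:E.
Proof.
move=> D nx; have [s [s0 s1 xE ellx]] := ell_between nx.
have /andP[xT xt] := nx.
have T0 : 0 <= T n.+1 by exact: (@T_homo 0).
have [TE ME tE mE] := vertices_keep D.
have Mm := upper_gt_lower n.
have Tt : T n.+1 < t n.+1 by lra.
have m1 := m_ge1 n.+1.
set r0 := (1 - s) * T n.+1 + s * t n.+1.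
have T_le_r0 : T n.+1 <= r0 by rewrite /r0; nra.
have r0_lt_t : r0 < t n.+1 by rewrite /r0; nra.
have xr0 : ell x = x - r0.
  by rewrite ellx xE /r0 TE ME tE mE; ring.
rewrite (@measure_tail x r0); first by rewrite xr0.
  have : 0 <= ell x by rewrite ellx mE ME; nra.
  by rewrite xr0 subr_ge0 => ->; rewrite (le_trans T0).
move=> r /andP[r_ge0 rx].
have tT := t_lt_T n.
have tT1 := t_lt_T n.+1.
have tT2 := t_lt_T n.+2.
have [rt|tr] := ltP r (t n).
  by have := forward_le r_ge0 rt; split; lra.
have [rT|Tr] := ltP r (T n.+1).
  have rn : t n <= r < T n.+1 by rewrite tr.
  rewrite (ell_rising rn); have := rising_slope n; have := alpha_gt0 n.
  by move=> a0 sl; split; nra.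
have [rt1|tr1] := ltP r (t n.+1).
  have rn : T n.+1 <= r < t n.+1 by rewrite Tr.
  have [s' [s'0 s'1 rE ellr]] := ell_between rn.
  have E1 : r + ell r - x = (s' - s) * (t n.+2 - T n.+2).
    by rewrite ellr {1}rE xE TE tE; ring.
  have E2 : r - r0 = (s' - s) * (t n.+1 - T n.+1).
    by rewrite {1}rE /r0; ring.
  rewrite -subr_gt0 E1 -[r0 < r]subr_gt0 E2 !pmulr_lgt0 ?subr_gt0//.
  exact: le_lt_trans xt.
split=> _; first exact: lt_le_trans tr1.
have [rT1|Tr1] := ltP r (T n.+2); last by have := forward_ge Tr1; lra.
have rn : t n.+1 <= r < T n.+2 by rewrite tr1.
by rewrite (ell_rising rn); have := alpha_gt0 n.+1; nra.
Qed.

(** The same rising line seen from its upper end, as needed to compare it with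
    the falling stretch that follows. *)
Lemma rising_preimage_right n x : rising_preimage n x =
  T n.+1 + (x - (T n.+1 + M n.+1)) * (1 - alpha n.+1).
Proof.
rewrite rising_slope /rising_preimage.
transitivity (T n.+1 + (x - (T n.+1 + (m n + alpha n * (T n.+1 - t n))))
    * (1 - alpha n.+1)
  + (T n.+1 - t n) * ((1 + alpha n) * (1 - alpha n.+1) - 1)); first by ring.
by rewrite alpha_recursion; ring.
Qed.

(** With a swap, [r + ell r] passes the level [x] three times: upwards before
    [T n.+1], downwards at [r2] between [T n.+1] and [t n.+1], and upwards again
    from [t n.+1] on. When [T n.+1 = t n.+1] the middle crossing is the jump,
    and [r2] is that abscissa. *)
Lemma delay_swap n x : t n.+1 + m n.+1 < T n.+1 + M n.+1 ->
  T n.+2 <= x < t n.+2 ->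
  delay_measure x = (ell x)%:E.
Proof.
move=> D nx; have [s [s0 s1 xE ellx]] := ell_between nx.
have /andP[xT xt] := nx.
have [TE ME tE mE] := vertices_swap D.
have tT := t_lt_T n.
have tT1 := t_lt_T n.+1.
have tT2 := t_lt_T n.+2.
have Tt1 := T_le_t n.+1.
have t0 : 0 <= t n by exact: (@t_homo 0).
have /andP[p1 p1'] : t n <= rising_preimage n x < T n.+1.
  by apply: rising_preimage_bounds; [have := t_next_ge n; lra|lra].
have /andP[p3 p3'] : t n.+1 <= rising_preimage n.+1 x < T n.+2.
  by apply: rising_preimage_bounds; [lra|have := T_next_le_T n.+1; lra].
(* Here [r + ell r] reverses the order of [T n.+1] and [t n.+1], so the ratio
   [s] is measured from [t n.+1]. *)
set r2 := (1 - s) * t n.+1 + s * T n.+1.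
have T_le_r2 : T n.+1 <= r2 by rewrite /r2; nra.
have r2_le_t : r2 <= t n.+1 by rewrite /r2; nra.
rewrite (@measure_two_pieces x (rising_preimage n x) r2
          (rising_preimage n.+1 x)); [|lra..|].
  rewrite ellx (rising_preimage_right n) /rising_preimage /r2 ME mE xE TE tE.
  by congr EFin; ring.
move=> r /andP[r_ge0 rx].
have [rt|tr] := ltP r (t n).
  by have := forward_le r_ge0 rt; split; lra.
have [rT|Tr] := ltP r (T n.+1).
  have rn : t n <= r < T n.+1 by rewrite tr.
  by rewrite (@rising_crossing n)//; split; lra.
have [rt1|tr1] := ltP r (t n.+1).
  have rn : T n.+1 <= r < t n.+1 by rewrite Tr.
  have [s' [s'0 s'1 rE ellr]] := ell_between rn.
  have E1 : r + ell r - x = (1 - s - s') * (t n.+2 - T n.+2).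
    by rewrite ellr {1}rE xE TE tE; ring.
  have E2 : r2 - r = (1 - s - s') * (t n.+1 - T n.+1).
    by rewrite {1}rE /r2; ring.
  have E : (x < r + ell r) = (r < r2).
    rewrite -subr_gt0 E1 -[RHS]subr_gt0 E2 !pmulr_lgt0 ?subr_gt0//.
      exact: le_lt_trans rt1.
    exact: le_lt_trans xt.
  by rewrite E; split; lra.
have [rT1|Tr1] := ltP r (T n.+2).
  have rn : t n.+1 <= r < T n.+2 by rewrite tr1.
  by rewrite (@rising_crossing n.+1)//; split; lra.
by have := forward_ge Tr1; split; lra.
Qed.

(** The stretches of index 0 and 1 are empty. *)
Lemma delay_between n x : T n <= x < t n ->
  delay_measure x = (ell x)%:E.
Proof.
case: n => [|[|n]]; first by case/andP=> /le_lt_trans h /h; rewrite ltxx.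
  by case: vertices1 => -> _ -> _ /andP[/le_lt_trans h /h]; rewrite ltxx.
have [D|D] := leP (T n.+1 + M n.+1) (t n.+1 + m n.+1).
- exact: delay_keep.
- exact: delay_swap.
Qed.

End Interpolant.
End Vertices.

Theorem theorem8p1 (R : realType) :
  (exists ell : R -> R, has_polygonal_graph ell) /\
  (forall ell : R -> R, has_polygonal_graph ell ->
    forall t : R, 0 <= t ->
      (ell t)%:E =
      ((u0 t)%:E +
       lebesgue_measure [set s : R | (0 <= s <= t)%R /\ (s < ell (t - s))%R])%E).
Proof.
split=> [|ell /polygonal_graph_interpolatesP ellP x x0].
  have [ell ellP] := interpolant_exists (@vertex_homo R).
  by exists ell; apply/polygonal_graph_interpolatesP.
rewrite /u0 indicE mem_setE in_itv /= x0 /=.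
have [x1|x1] := ltP x 1.
  rewrite delay_first ?x0//; rewrite -EFinD; congr EFin => /=; ring.
rewrite add0e; have [T1 _ t1 _] := vertices1 R.
have [n [nx|nx]] := rising_or_between x0; last first.
  by rewrite (delay_between ellP nx).
case: n nx => [|n nx]; last by rewrite (delay_rising ellP nx).
by rewrite T1 => /andP[_]; rewrite ltNge x1.
Qed.
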